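(* Let $p$ be a prime and let $F(x)=\frac{Ax+B}{x^2+Cx+D}$ with $A,B,C,D\in\mathbb{Q}_p$, $A\neq 0$, $\sqrt{C^2-4D}\in\mathbb{Q}_p$, be a $(1,2)$-rational function on $\mathbb{Q}_p$ having two distinct fixed points, i.e. the fixed point equation $x^3+Cx^2+(D-A)x-B=0$ of $F$ has exactly two distinct solutions, one of which has multiplicity two, and both solutions are fixed points of $F$. Then $F$ is topologically conjugate to one of the following functions: $$f(x)=\frac{ax^2+bx}{x^2+cx+b},\qquad ab(a-c)\neq 0,\quad a,b,c\in\mathbb{Q}_p,$$ or $$f(x)=\frac{ax}{x^2+cx+a},\qquad ac\neq 0,\quad a,c\in\mathbb{Q}_p,$$ where in each case $x$ is different from the zeros of the denominator.
   Context: $\mathbb{Q}_p$ is the field of $p$-adic numbers. A $(1,2)$-rational function $F$ as in the claim is defined for all $x\in\mathbb{Q}_p$ other than the zeros $\frac{-C\pm\sqrt{C^2-4D}}{2}$ of the denominator. A fixed point of $F$ is a point $x_0$ of its domain with $F(x_0)=x_0$. Two such (partially defined) functions $F$ and $f$ on $\mathbb{Q}_p$ are topologically conjugate if there is a homeomorphism $h:\mathbb{Q}_p\to\mathbb{Q}_p$ carrying the domain of $f$ onto the domain of $F$ such that $F\circ h=h\circ f$ on the domain of $f$. *)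

(* Defs.v *)
From HB Require Import structures.
From mathcomp Require Import all_boot all_order all_algebra.
From mathcomp Require Import ring_quotient generic_quotient.
From mathcomp Require Import boolp classical_sets functions topology.
From mathcomp Require Import zify ring.

Set Implicit Arguments.
Unset Strict Implicit.
Unset Printing Implicit Defensive.

Import Order.TTheory GRing.Theory Num.Theory.
Local Open Scope ring_scope.

Definition padic_val (p : nat) (x : rat) : int :=
  (logn p `|numq x|)%:Z - (logn p `|denq x|)%:Z.

Definition padic_abs (p : nat) (x : rat) : rat :=
  if x == 0 then 0 else p%:Q ^ (- padic_val p x).

Section PadicAbs.
Variables (p : nat) (pp : prime p).
Implicit Types (x y : rat).
Local Notation v := (padic_val p).
Local Notation abs := (padic_abs p).

Let p_gt0 : 0 < p%:Q. Proof. by rewrite ltr0z ltz_nat prime_gt0. Qed.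
Let p_gt1 : 1 < p%:Q. Proof. by rewrite ltr1z ltz_nat prime_gt1. Qed.

Lemma padic_val_frac (n d : int) : n != 0 -> d != 0 ->
  v (n%:Q / d%:Q) = (logn p `|n|)%:Z - (logn p `|d|)%:Z.
Proof.
move=> n0 d0; set x := n%:Q / d%:Q.
have dQ0 : d%:Q != 0 by rewrite intr_eq0.
have x0 : x != 0 by rewrite mulf_neq0 ?invr_eq0 // intr_eq0.
have nx0 : numq x != 0 by rewrite numq_eq0.
have E : numq x * d = n * denq x.
  apply: (@intr_inj rat); rewrite !intrM numqE /x mulrAC divfK //.
have := congr1 (fun z : int => logn p `|z|%N) E.
rewrite !abszM !lognM ?absz_gt0 ?denq_neq0 // /padic_val; lia.
Qed.

Lemma padic_valM x y : x != 0 -> y != 0 -> v (x * y) = v x + v y.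
Proof.
move=> x0 y0; rewrite -{1}(divq_num_den x) -{1}(divq_num_den y) mulf_div -!intrM.
rewrite padic_val_frac ?mulf_neq0 ?numq_eq0 ?denq_neq0 //.
rewrite !abszM !lognM ?absz_gt0 ?numq_eq0 ?denq_neq0 // /padic_val; lia.
Qed.

Lemma logn_addz (m n : int) : m != 0 -> n != 0 -> m + n != 0 ->
  (minn (logn p `|m|) (logn p `|n|) <= logn p `|(m + n)%R|)%N.
Proof.
move=> m0 n0 mn0; set k := minn _ _.
rewrite -pfactor_dvdn ?absz_gt0 //.
have dvd (z : int) : z != 0 -> (k <= logn p `|z|)%N -> (Posz (p ^ k) %| z)%Z.
  by move=> z0 kz; rewrite dvdzE absz_nat pfactor_dvdn ?absz_gt0.
have : (Posz (p ^ k) %| m + n)%Z.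
  by apply: rpredD; apply: dvd; rewrite ?geq_minl ?geq_minr.
by rewrite dvdzE absz_nat.
Qed.

Lemma padic_valD x y : x != 0 -> y != 0 -> x + y != 0 ->
  (v x <= v (x + y)) || (v y <= v (x + y)).
Proof.
move=> x0 y0 xy0.
set d := denq x * denq y; set m := numq x * denq y; set n := numq y * denq x.
have d0 : d != 0 by rewrite mulf_neq0 ?denq_neq0.
have dx : (denq x)%:Q != 0 by rewrite intr_eq0 denq_neq0.
have dy : (denq y)%:Q != 0 by rewrite intr_eq0 denq_neq0.
have xE : x = m%:Q / d%:Q by rewrite -{1}(divq_num_den x) /m /d !intrM; field; rewrite dx dy.
have yE : y = n%:Q / d%:Q by rewrite -{1}(divq_num_den y) /n /d !intrM; field; rewrite dx dy.
have sE : x + y = (m + n)%:Q / d%:Q by rewrite xE yE -mulrDl -intrD.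
have m0 : m != 0 by apply: contraNneq x0 => m0; rewrite xE m0 mul0r.
have n0 : n != 0 by apply: contraNneq y0 => n0; rewrite yE n0 mul0r.
have s0 : m + n != 0 by apply: contraNneq xy0 => s0; rewrite sE s0 mul0r.
rewrite sE xE yE !padic_val_frac // !lerD2r !lez_nat -geq_min.
exact: logn_addz.
Qed.

Lemma padic_abs0 : abs 0 = 0. Proof. by rewrite /padic_abs eqxx. Qed.

Lemma padic_abs_eq0 x : (abs x == 0) = (x == 0).
Proof.
rewrite /padic_abs; case: (eqVneq x 0) => [|x0]; first by rewrite eqxx.
by rewrite expfz_eq0 (gt_eqF p_gt0) andbF.
Qed.

Lemma padic_abs_ge0 x : 0 <= abs x.
Proof. by rewrite /padic_abs; case: ifP => // _; rewrite exprz_ge0 // ltW. Qed.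

Lemma padic_absM x y : abs (x * y) = abs x * abs y.
Proof.
rewrite /padic_abs mulf_eq0.
case: (eqVneq x 0) => [|x0] /=; first by rewrite mul0r.
case: (eqVneq y 0) => [|y0] /=; first by rewrite mulr0.
by rewrite padic_valM // opprD expfzDr // (gt_eqF p_gt0).
Qed.

Lemma padic_abs1 : abs 1 = 1.
Proof.
have -> : (1 : rat) = 1%:Q by [].
by rewrite /padic_abs intr_eq0 /padic_val numq_int denq_int subrr oppr0 expr0z.
Qed.

Lemma padic_absN x : abs (- x) = abs x.
Proof. by rewrite /padic_abs oppr_eq0 /padic_val numqN denqN abszN. Qed.

Lemma padic_absB x y : abs (x - y) = abs (y - x).
Proof. by rewrite -padic_absN opprB. Qed.

Lemma padic_absV x : abs (x^-1) = (abs x)^-1.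
Proof.
have [->|x0] := eqVneq x 0; first by rewrite !(invr0, padic_abs0).
have a0 : abs x != 0 by rewrite padic_abs_eq0.
by apply: (mulfI a0); rewrite -padic_absM !divff // padic_abs1.
Qed.

Lemma padic_absD x y : abs (x + y) <= Num.max (abs x) (abs y).
Proof.
have [->|x0] := eqVneq x 0; first by rewrite add0r le_max lexx orbT.
have [->|y0] := eqVneq y 0; first by rewrite addr0 le_max lexx.
have [s0|s0] := eqVneq (x + y) 0.
  by rewrite s0 padic_abs0 le_max padic_abs_ge0.
rewrite le_max /padic_abs (negPf x0) (negPf y0) (negPf s0).
by rewrite !ler_eXz2l // !lerN2 padic_valD.
Qed.

Lemma padic_absD_lt x y (e : rat) : abs x < e -> abs y < e -> abs (x + y) < e.
Proof. by move=> xe ye; apply: le_lt_trans (padic_absD x y) _; rewrite gt_max xe. Qed.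

Lemma padic_absB_lt x y (e : rat) : abs x < e -> abs y < e -> abs (x - y) < e.
Proof. by move=> xe ye; apply: padic_absD_lt; rewrite ?padic_absN. Qed.

Lemma padic_abs_eq x y : abs (x - y) < abs x -> abs y = abs x.
Proof.
move=> h; apply/eqP; rewrite eq_le; apply/andP; split.
  have := padic_absD x (y - x); rewrite addrC subrK padic_absB le_max.
  by case/orP => // /le_trans; apply; apply: ltW.
rewrite leNgt; apply/negP => yx.
by have := padic_absD_lt h yx; rewrite subrK ltxx.
Qed.

Definition padic_cauchy : {pred nat -> rat} := fun u =>
  `[< forall e : rat, 0 < e -> exists N : nat,
        forall m n : nat, (N <= m)%N -> (N <= n)%N -> abs (u m - u n) < e >].

Definition padic_null (u : nat -> rat) :=
  `[< forall e : rat, 0 < e -> exists N : nat,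
        forall n : nat, (N <= n)%N -> abs (u n) < e >].

Lemma padic_cauchy_bounded u : u \in padic_cauchy ->
  exists2 M : rat, 0 < M & forall n, abs (u n) <= M.
Proof.
move=> /asboolP /(_ 1 ltr01) [N hN].
have [M0 M0_ge] : exists M : rat, forall n, (n < N)%N -> abs (u n) <= M.
  elim: N {hN} => [|N [M hM]]; first by exists 0.
  exists (Num.max M (abs (u N))) => n; rewrite ltnS leq_eqVlt => /orP[/eqP->|/hM h].
    by rewrite le_max lexx orbT.
  by rewrite le_max h.
exists (Num.max M0 (Num.max 1 (abs (u N)))).
  by rewrite !lt_max ltr01 !orbT.
move=> n; have [nN|Nn] := ltnP n N; first by rewrite le_max M0_ge.
rewrite le_max; apply/orP; right.
rewrite -(subrK (u N) (u n)); apply: le_trans (padic_absD _ _) _.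
by rewrite ge_max !le_max lexx orbT andbT (ltW (hN _ _ Nn (leqnn N))).
Qed.

Lemma padic_cauchy_subring : subring_closed padic_cauchy.
Proof.
split.
- apply/asboolP => e e0; exists 0%N => m n _ _.
  by rewrite /GRing.one /= /cst subrr padic_abs0.
- move=> u w /asboolP hu /asboolP hw; apply/asboolP => e e0.
  have [N hN] := hu e e0; have [M hM] := hw e e0.
  exists (maxn N M) => m n; rewrite !geq_max => /andP[Nm Mm] /andP[Nn Mn].
  have -> : (u - w) m - (u - w) n = (u m - u n) - (w m - w n).
    by rewrite -[LHS]/((u m - w m) - (u n - w n)); ring.
  by apply: padic_absB_lt; [exact: hN|exact: hM].
- move=> u w cu cw.
  have [Mu Mu0 hMu] := padic_cauchy_bounded cu.
  have [Mw Mw0 hMw] := padic_cauchy_bounded cw.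
  move: cu cw => /asboolP hu /asboolP hw; apply/asboolP => e e0.
  have [N hN] := hu _ (divr_gt0 e0 Mw0); have [M hM] := hw _ (divr_gt0 e0 Mu0).
  exists (maxn N M) => m n; rewrite !geq_max => /andP[Nm Mm] /andP[Nn Mn].
  have -> : (u * w) m - (u * w) n = u m * (w m - w n) + (u m - u n) * w n.
    by rewrite -[LHS]/(u m * w m - u n * w n); ring.
  apply: padic_absD_lt; rewrite padic_absM.
    apply: (le_lt_trans (ler_wpM2r (padic_abs_ge0 _) (hMu m))).
    by rewrite mulrC -ltr_pdivlMr //; apply: hM.
  apply: (le_lt_trans (ler_wpM2l (padic_abs_ge0 _) (hMw n))).
  by rewrite -ltr_pdivlMr //; apply: hN.
Qed.

Lemma padic_cauchy_eventually u : u \in padic_cauchy -> ~ padic_null u ->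
  exists2 r : rat, 0 < r &
    exists N : nat, forall n : nat, (N <= n)%N -> abs (u n) = r.
Proof.
move=> /asboolP cu nu.
have [e e0 hu] : exists2 e : rat, 0 < e &
    forall N : nat, exists2 n : nat, (N <= n)%N & e <= abs (u n).
  apply: contrapT => h; apply: nu; apply/asboolP => e e0.
  apply: contrapT => h2; apply: h; exists e => // N.
  apply: contrapT => h3; apply: h2; exists N => n Nn.
  by rewrite ltNge; apply/negP => en; apply: h3; exists n.
have [N hN] := cu e e0; have [n Nn en] := hu N.
exists (abs (u n)); first exact: lt_le_trans en.
exists N => m Nm; apply: padic_abs_eq.
by apply: lt_le_trans en; apply: hN.
Qed.

End PadicAbs.

(* The ring of p-adic Cauchy sequences of rationals.  The primality proof is a
   parameter so that canonical structures can be inferred from the type. *)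
Record padic_seq (p : nat) (pp : prime p) := PadicSeq {
  padic_seq_fun :> nat -> rat;
  _ : padic_seq_fun \in padic_cauchy p }.

HB.instance Definition _ (p : nat) (pp : prime p) :=
  [isSub for @padic_seq_fun p pp].
HB.instance Definition _ (p : nat) (pp : prime p) :=
  [Choice of padic_seq pp by <:].
HB.instance Definition _ (p : nat) (pp : prime p) :=
  GRing.SubChoice_isSubComNzRing.Build _ _ (padic_seq pp)
    (padic_cauchy_subring pp).

Definition padic_null_ideal (p : nat) (pp : prime p) : {pred padic_seq pp} :=
  fun u => padic_null p u.

Lemma padic_null_idealr (p : nat) (pp : prime p) :
  idealr_closed (@padic_null_ideal p pp).
Proof.
split.
- by apply/asboolP => e e0; exists 0%N => n _; rewrite padic_abs0.
- apply/negP => /asboolP /(_ 1 ltr01) [N /(_ N (leqnn N))].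
  by rewrite padic_abs1 ltxx.
move=> a u w /asboolP hu /asboolP hw; apply/asboolP => e e0.
have [M M0 hM] : exists2 M : rat, 0 < M & forall n, padic_abs p (a n) <= M.
  exact: (padic_cauchy_bounded pp (valP a)).
have [N hN] := hu _ (divr_gt0 e0 M0); have [N' hN'] := hw e e0.
exists (maxn N N') => n; rewrite geq_max => /andP[Nn Nn'].
have -> : (a * u + w : padic_seq pp) n = a n * u n + w n by [].
apply: (padic_absD_lt pp); last exact: hN'.
rewrite (padic_absM pp).
apply: (le_lt_trans (ler_wpM2r (padic_abs_ge0 _ _) (hM n))).
by rewrite mulrC -ltr_pdivlMr //; apply: hN.
Qed.

HB.instance Definition _ (p : nat) (pp : prime p) :=
  isIdealr.Build (padic_seq pp) (@padic_null_ideal p pp)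
    (@padic_null_idealr p pp).

(* The field of p-adic numbers: Cauchy sequences modulo null sequences. *)
Definition Qp (p : nat) (pp : prime p) : Type :=
  {ideal_quot (@padic_null_ideal p pp)}.

HB.instance Definition _ (p : nat) (pp : prime p) := GRing.ComNzRing.on (Qp pp).

Section QpField.
Variables (p : nat) (pp : prime p).
Implicit Types (x y : Qp pp) (u w : padic_seq pp).
Local Open Scope quotient_scope.
Local Notation pi := (\pi_{ideal_quot (@padic_null_ideal p pp)}).

Lemma Qp_eq u w : (pi u == pi w :> Qp pp) = padic_null p (u - w).
Proof. by rewrite -Quotient.idealrBE. Qed.

Lemma Qp_piK x : pi (repr x) = x. Proof. exact: reprK. Qed.

Lemma Qp_eventually x : x != 0 ->
  exists2 r : rat, 0 < r &
    exists N : nat, forall n : nat, (N <= n)%N -> padic_abs p (repr x n) = r.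
Proof.
move=> x0; apply: (padic_cauchy_eventually pp); first exact: (valP (repr x)).
move=> xn; case/negP: x0; rewrite -(Qp_piK x).
have -> : (0 : Qp pp) = pi 0 by rewrite raddf0.
by rewrite Qp_eq subr0.
Qed.

Lemma Qp_inv_ex x : x != 0 -> exists y, y * x = 1.
Proof.
move=> x0; have [r r0 [N hN]] := Qp_eventually x0.
set u := repr x in hN.
have un0 n : (N <= n)%N -> u n != 0.
  by move=> Nn; rewrite -(padic_abs_eq0 pp) hN // gt_eqF.
have cw : (fun n => (u n)^-1) \in padic_cauchy p.
  apply/asboolP => e e0.
  have /asboolP cu : (u : nat -> rat) \in padic_cauchy p by exact: (valP u).
  have [M hM] := cu _ (mulr_gt0 (mulr_gt0 r0 r0) e0).
  exists (maxn N M) => m n; rewrite !geq_max => /andP[Nm Mm] /andP[Nn Mn].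
  have um0 := un0 m Nm; have vn0 := un0 n Nn.
  have -> : (u m)^-1 - (u n)^-1 = (u n - u m) * ((u m)^-1 * (u n)^-1).
    by field; rewrite um0 vn0.
  rewrite !(padic_absM pp) !(padic_absV pp) !hN // -invfM ltr_pdivrMr ?mulr_gt0 //.
  by rewrite mulrC; apply: hM.
exists (pi (PadicSeq pp cw)).
rewrite -{1}(Qp_piK x).
have -> : (1 : Qp pp) = pi 1 by rewrite rmorph1.
rewrite -rmorphM; apply/eqP; rewrite Qp_eq; apply/asboolP => e e0.
exists N => n Nn.
have -> : (PadicSeq pp cw * repr x - 1 : padic_seq pp) n = (u n)^-1 * u n - 1.
  by [].
by rewrite mulVf ?un0 // subrr padic_abs0.
Qed.

Definition Qp_inv x : Qp pp := xget 0 [set y | y * x = 1]%classic.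

Lemma Qp_mulVf x : x != 0 -> Qp_inv x * x = 1.
Proof. by move=> /Qp_inv_ex[y xy]; apply: (@xgetI _ 0 [set y | y * x = 1]%classic y). Qed.

Lemma Qp_inv0 : Qp_inv 0 = 0.
Proof.
apply: xgetPN => y /= /eqP; rewrite mulr0 eq_sym; apply/negP; exact: oner_neq0.
Qed.

(* |x|_p is the limit of |u_n|_p for any Cauchy sequence u representing x; when
   x is nonzero the sequence |u_n|_p is eventually constant. *)
Definition Qp_abs x : rat :=
  if x == 0 then 0
  else xget 0 [set r | exists N : nat, forall n : nat,
                         (N <= n)%N -> padic_abs p (repr x n) = r]%classic.

Lemma Qp_abs_repr_lt x (e : rat) : 0 < e -> Qp_abs x < e <->
  exists N : nat, forall n : nat, (N <= n)%N -> padic_abs p (repr x n) < e.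
Proof.
move=> e0; rewrite /Qp_abs; case: (eqVneq x 0) => [->|x0].
  split=> // _.
  have /eqP : pi (repr (0 : Qp pp)) = pi 0 by rewrite Qp_piK raddf0.
  by rewrite Qp_eq subr0 => /asboolP /(_ e e0).
set E := (X in xget _ X).
have [r r0 Er] := Qp_eventually x0.
have [N hN] : E (xget 0 E) := xgetI 0 Er.
split=> [lt_e|[M hM]]; first by exists N => n Nn; rewrite hN.
by rewrite -(hN (maxn N M)) ?leq_maxl // hM // leq_maxr.
Qed.

Lemma Qp_abs_lt u (e : rat) : 0 < e -> Qp_abs (pi u) < e <->
  exists N : nat, forall n : nat, (N <= n)%N -> padic_abs p (u n) < e.
Proof.
move=> e0; rewrite Qp_abs_repr_lt //.
set w := repr _.
have /eqP : pi w = pi u by rewrite Qp_piK.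
rewrite Qp_eq => /asboolP /(_ e e0) [M hM].
split=> -[N hN]; exists (maxn N M) => n; rewrite geq_max => /andP[Nn Mn].
  have -> : u n = w n - (w - u : padic_seq pp) n.
    by rewrite -[(w - u : padic_seq pp) n]/(w n - u n) subKr.
  by apply: (padic_absB_lt pp); [exact: hN|exact: hM].
have -> : w n = (w - u : padic_seq pp) n + u n.
  by rewrite -[(w - u : padic_seq pp) n]/(w n - u n) subrK.
by apply: (padic_absD_lt pp); [exact: hM|exact: hN].
Qed.

Lemma Qp_abs_ge0 x : 0 <= Qp_abs x.
Proof.
rewrite /Qp_abs; case: ifPn => // x0; set E := (X in xget _ X).
have [r r0 Er] := Qp_eventually x0.
have [N hN] : E (xget 0 E) := xgetI 0 Er.
by rewrite -(hN N) // padic_abs_ge0.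
Qed.

Lemma Qp_abs0 : Qp_abs 0 = 0. Proof. by rewrite /Qp_abs eqxx. Qed.

Lemma Qp_abs_eq0 x : Qp_abs x = 0 -> x = 0.
Proof.
rewrite /Qp_abs; case: eqVneq => // x0; set E := (X in xget _ X).
have [r r0 [N hN]] := Qp_eventually x0.
have [M hM] : E (xget 0 E) by apply: (@xgetI _ 0 E r); exists N.
rewrite -(hM (maxn N M)) ?leq_maxr // hN ?leq_maxl // => r_eq0.
by rewrite r_eq0 ltxx in r0.
Qed.

Lemma Qp_absB x y : Qp_abs (x - y) = Qp_abs (y - x).
Proof.
suff le a b : Qp_abs (a - b) <= Qp_abs (b - a).
  by apply/eqP; rewrite eq_le !le.
rewrite leNgt; apply/negP => h.
have e0 := le_lt_trans (Qp_abs_ge0 _) h; move: (h).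
rewrite -(Qp_piK a) -(Qp_piK b) -!raddfB in e0 h *.
move/(Qp_abs_lt _ e0) => [N hN].
have : Qp_abs (pi (repr a - repr b)) < Qp_abs (pi (repr a - repr b)).
  apply/(Qp_abs_lt _ e0); exists N => n Nn.
  rewrite -[(_ : padic_seq pp) n]/(repr a n - repr b n) padic_absB.
  exact: hN.
by rewrite ltxx.
Qed.

Lemma Qp_absD x y : Qp_abs (x + y) <= Num.max (Qp_abs x) (Qp_abs y).
Proof.
rewrite leNgt gt_max; apply/negP => /andP[].
rewrite -(Qp_piK x) -(Qp_piK y) -raddfD => hx hy.
have e0 := le_lt_trans (Qp_abs_ge0 _) hx.
move: (hx) (hy) => /(Qp_abs_lt _ e0) [N hN] /(Qp_abs_lt _ e0) [M hM].
have : Qp_abs (pi (repr x + repr y)) < Qp_abs (pi (repr x + repr y)).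
  apply/(Qp_abs_lt _ e0); exists (maxn N M) => n.
  rewrite geq_max => /andP[Nn Mn].
  rewrite -[X in padic_abs p X < _]/(repr x n + repr y n).
  by apply: (padic_absD_lt pp); [exact: hN|exact: hM].
by rewrite ltxx.
Qed.

Definition Qp_dist x y : rat := Qp_abs (x - y).

Lemma Qp_distxx x : Qp_dist x x = 0.
Proof. by rewrite /Qp_dist subrr Qp_abs0. Qed.

Lemma Qp_dist_positivity x y : Qp_dist x y = 0 -> x = y.
Proof. by move/Qp_abs_eq0/eqP; rewrite subr_eq0 => /eqP. Qed.

Lemma Qp_dist_sym x y : Qp_dist x y = Qp_dist y x.
Proof. exact: Qp_absB. Qed.

Lemma Qp_dist_triangle y x z : Qp_dist x z <= Qp_dist x y + Qp_dist y z.
Proof.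
rewrite /Qp_dist -{1}(subrK y x) -addrA.
apply: le_trans (Qp_absD _ _) _.
by rewrite ge_max lerDl lerDr !Qp_abs_ge0.
Qed.

End QpField.

HB.instance Definition _ (p : nat) (pp : prime p) :=
  GRing.ComNzRing_isField.Build (Qp pp) (@Qp_mulVf p pp) (@Qp_inv0 p pp).

HB.instance Definition _ (p : nat) (pp : prime p) :=
  isMetric.Build rat (Qp pp) (@Qp_distxx p pp) (@Qp_dist_positivity p pp)
    (@Qp_dist_sym p pp) (@Qp_dist_triangle p pp).

Local Open Scope classical_set_scope.

(* A partially defined self-map: [pfun_map] is only meaningful on [pfun_dom]. *)
Record pfun (T : Type) := PFun { pfun_dom : set T; pfun_map : T -> T }.

Definition ratfun (K : fieldType) (N D : {poly K}) : pfun K :=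
  PFun [set x | D.[x] != 0] (fun x => N.[x] / D.[x]).

Definition fixed_point (T : Type) (F : pfun T) (x : T) : Prop :=
  pfun_dom F x /\ pfun_map F x = x.

Definition homeomorphism (T U : topologicalType) (h : T -> U) : Prop :=
  continuous h /\
  exists g : U -> T, [/\ cancel h g, cancel g h & continuous g].

Definition top_conjugate (T : topologicalType) (F f : pfun T) : Prop :=
  exists h : T -> T,
    [/\ homeomorphism h,
        h @` pfun_dom f = pfun_dom F &
        forall x, pfun_dom f x -> pfun_map F (h x) = h (pfun_map f x)].

(* Main.v *)
Require Import Defs.
From mathcomp Require Import all_boot all_order all_algebra.
From mathcomp Require Import boolp classical_sets topology.
From mathcomp Require Import ring.

Import GRing.Theory.
Local Open Scope ring_scope.

(** Let [x1] be the double root of [P], [x2] the simple one, and write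
    [Q = x^2 + C x + D] for the denominator of [F].  The conjugating
    homeomorphism is the translation [x |-> x + x1], which moves the fixed point
    [x1] to the origin.  The conjugated function is
    [(Ax + A x1 + B - x1 Q(x + x1)) / Q(x + x1)], and three facts put it in
    normal form:
    - [P(x1) = 0] kills the constant term of its numerator;
    - [P'(x1) = 0], which holds because [x1] is a multiple root, says that the
      linear coefficient of the numerator is [Q(x1)], the constant term of the
      denominator; call it [b];
    - the Taylor expansion of [P] at [x1], evaluated at [x2], reads
      [(x2 - x1)^2 (x2 + 2 x1 + C) = 0], so that [a = - x1] and
      [c = 2 x1 + C] satisfy [a - c = x2 - x1 != 0].
    Moreover [b != 0] since [x1] is in the domain of [F].  So the conjugated
    function is [(a x^2 + b x) / (x^2 + c x + b)]; this is the first family when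
    [a != 0], and the second one, with parameters [b] and [c], when [a = 0]. *)

(** The p-adic distance is translation invariant. *)
Lemma Qp_translation_continuous (p : nat) (pp : prime p) (t : Qp pp) :
  continuous (fun x : Qp pp => x + t).
Proof.
move=> x U /nbhs_ballP[e e0 xeU].
apply/nbhs_ballP; exists e => // y xy; apply: xeU; move: xy.
by rewrite !ballEmdist /= /mdist /= /Qp_dist opprD addrACA subrr addr0.
Qed.

Lemma Qp_translation_homeomorphism (p : nat) (pp : prime p) (t : Qp pp) :
  homeomorphism (fun x : Qp pp => x + t).
Proof.
split; first exact: Qp_translation_continuous.
exists (fun x => x - t); split; [exact: addrK|exact: subrK|].
exact: Qp_translation_continuous.
Qed.

(** Pointwise hypotheses, rather than polynomial compositions, let the
    coefficients of the translated fraction be given in any form. *)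
Lemma ratfun_translation_conjugate (p : nat) (pp : prime p) (t : Qp pp)
    (N D N' D' : {poly Qp pp}) :
  (forall x, D'.[x] = D.[x + t]) ->
  (forall x, N'.[x] = N.[x + t] - t * D.[x + t]) ->
  top_conjugate (ratfun N D) (ratfun N' D').
Proof.
move=> D'E N'E; exists (fun x => x + t); split=> /=.
- exact: Qp_translation_homeomorphism.
- apply/seteqP; split=> [_ [x /= Dx <-]|y /= Dy]; first by rewrite -D'E.
  by exists (y - t); rewrite /= ?D'E subrK.
- by move=> x Dx; rewrite N'E D'E mulrBl mulfK ?subrK // -D'E.
Qed.

Lemma root_deriv_mup (K : fieldType) (x : K) (q : {poly K}) :
  (1 < mup x q)%N -> root q^`() x.
Proof.
have [->|q0] := eqVneq q 0; first by rewrite deriv0 root0.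
rewrite mup_geq // => /dvdpP[r ->].
by rewrite /root expr2 mulrA derivM hornerD !hornerM hornerXsubC subrr
  !(mulr0, mul0r) addr0.
Qed.

Theorem proposition1 (p : nat) (pp : prime p) (A B C D : Qp pp) :
  let F := ratfun (A *: 'X + B%:P) ('X^2 + C *: 'X + D%:P) in
  let P := 'X^3 + C *: 'X^2 + (D - A) *: 'X - B%:P in
  A != 0 ->
  (exists s : Qp pp, s ^+ 2 = C ^+ 2 - 4%:R * D) ->
  (exists x1 x2 : Qp pp,
    [/\ x1 != x2,
        (forall x : Qp pp, root P x <-> x = x1 \/ x = x2),
        mup x1 P = 2%N,
        fixed_point F x1 &
        fixed_point F x2]) ->
  (exists a b c : Qp pp,
     a * b * (a - c) != 0 /\
     top_conjugate F (ratfun (a *: 'X^2 + b *: 'X) ('X^2 + c *: 'X + b%:P)))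
  \/
  (exists a c : Qp pp,
     a * c != 0 /\
     top_conjugate F (ratfun (a *: 'X) ('X^2 + c *: 'X + a%:P))).
Proof.
move=> F P _ _ [x1 [x2 [x12 rootP mupP [/= Q1 _] _]]].
have PE x : P.[x] = x ^+ 3 + C * x ^+ 2 + (D - A) * x - B by rewrite !hornerE.
have P1 : P.[x1] = 0 by apply/eqP/rootP; left.
have P2 : P.[x2] = 0 by apply/eqP/rootP; right.
have dP1 : x1 ^+ 2 *+ 3 + C * x1 *+ 2 + (D - A) = 0.
  have /eqP <- : root P^`() x1 by apply: root_deriv_mup; rewrite mupP.
  rewrite derivB !derivD !derivZ derivX derivC !derivXn.
  by rewrite !(hornerD, hornerN, hornerZ, hornerXn, hornerC); ring.
rewrite !hornerE in Q1; rewrite !PE in P1 P2.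
pose a : Qp pp := - x1.
pose b : Qp pp := x1 ^+ 2 + C * x1 + D.
pose c : Qp pp := x1 *+ 2 + C.
have bE : b = A - x1 ^+ 2 *+ 2 - C * x1.
  by apply/eqP; rewrite -subr_eq0 -dP1 /b; apply/eqP; ring.
have acE : a - c = x2 - x1.
  have x21 : (x2 - x1) ^+ 2 != 0 by rewrite expf_neq0 // subr_eq0 eq_sym.
  apply/eqP; rewrite eq_sym -subr_eq0 -(mulrI_eq0 _ (mulfI x21)).
  (* Taylor expansion of [P] at [x1]; [x2 - x1 - (a - c)] is [x2 + 2 x1 + C]. *)
  have -> : (x2 - x1) ^+ 2 * (x2 - x1 - (a - c)) =
      (x2 ^+ 3 + C * x2 ^+ 2 + (D - A) * x2 - B)
    - (x1 ^+ 3 + C * x1 ^+ 2 + (D - A) * x1 - B)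
    - (x1 ^+ 2 *+ 3 + C * x1 *+ 2 + (D - A)) * (x2 - x1).
    by rewrite /a /c; ring.
  by rewrite P1 P2 dP1 mul0r !subr0.
have ac0 : a - c != 0 by rewrite acE subr_eq0 eq_sym.
have conj : top_conjugate F
    (ratfun (a *: 'X^2 + b *: 'X) ('X^2 + c *: 'X + b%:P)).
  apply: (@ratfun_translation_conjugate _ _ x1) => x; rewrite !(hornerD, hornerN, hornerZ, hornerXn, hornerX, hornerC).
    by rewrite /b /c; ring.
  (* The two numerators differ by the constant [P.[x1]]. *)
  by apply/eqP; rewrite -subr_eq0 -[X in _ == X]P1 bE /a; apply/eqP; ring.
have [a0|a0] := eqVneq a 0.
  right; exists b, c; split; last by move: conj; rewrite a0 scale0r add0r.
  by move: ac0; rewrite a0 sub0r oppr_eq0 => c0; rewrite mulf_neq0.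
by left; exists a, b, c; split=> //; rewrite !mulf_neq0.
Qed.
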